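(* Let $L/K$ be an extension of real-valued fields such that $K$ is dense in $L$, and let $A\to K$ be a homomorphism of rings. Then the natural map $\psi_{L/K/A}:\Omega_{K/A}\otimes_KL\to\Omega_{L/A}$ is an isometry with a dense image.
   Context: A real-valued field is a field with a non-archimedean valuation with values in $\mathbb{R}_{\ge 0}$ (possibly trivial, not necessarily complete); in an extension $L/K$ of real-valued fields the valuation of $L$ extends that of $K$. For a homomorphism of rings $A\to K$ to a real-valued field, the Kähler seminorm on $\Omega_{K/A}$ is $\|x\|_\Omega=\inf\max_i|c_i|\,|b_i|$, the infimum being over all finite representations $x=\sum_i c_i\,d(b_i)$ with $c_i,b_i\in K$; the seminorm on $\Omega_{L/A}$ is defined similarly. The source $\Omega_{K/A}\otimes_KL$ is provided with the tensor seminorm $\|z\|=\inf\max_i\|m_i\|_\Omega\,|a_i|$, the infimum being over all finite representations $z=\sum_i m_i\otimes a_i$ with $m_i\in\Omega_{K/A}$, $a_i\in L$. The target $\Omega_{L/A}$ has its Kähler seminorm. A map is an isometry if it preserves seminorms (it is not required to be injective or surjective); density is with respect to the topology of the seminorm. *)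

(* Defs.v *)
From HB Require Import structures.
From mathcomp Require Import all_boot all_order ssralg ssrnum ring_quotient.
From mathcomp Require Import sesquilinear.
From mathcomp.multinomials Require Import freeg.
From mathcomp Require Import boolp classical_sets reals topology.

Set Implicit Arguments.
Unset Strict Implicit.
Unset Printing Implicit Defensive.

Import Order.TTheory GRing.Theory Num.Theory.
Local Open Scope ring_scope.
Local Open Scope classical_set_scope.

Lemma addKB (V : zmodType) (u v : V) : u + v - u - v = 0.
Proof. by rewrite [u + v]addrC addrK subrr. Qed.

Section FreeModule.
Variables (B : nzRingType) (G : choiceType) (M : lmodType B) (g : G -> M).

Lemma fglift_is_linear : linear (fglift g : {freeg G / B} -> M).
Proof.
have gB : zmod_morphism (fglift g) by exact: lift_is_additive.
have g0 : fglift g 0 = 0 by rewrite -(subrr 0) gB subrr.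
have gD x y : fglift g (x + y) = fglift g x + fglift g y.
  by rewrite -{1}[y]opprK gB -[- y]sub0r gB g0 sub0r opprK.
move=> c D1 D2; rewrite gD; congr (_ + _).
rewrite -[D1]freeg_sumE; elim: (dom D1) => [|x s IHs].
  by rewrite !big_nil scaler0 g0 scaler0.
rewrite !big_cons scalerDr !gD IHs scalerDr; congr (_ + _).
have -> : c *: << coeff x D1 *g x >> = << c * coeff x D1 *g x >>.
  by apply/eqP/freeg_eqP => y; rewrite coeff_fgscale !coeffU mulrA.
by rewrite !liftU scalerA.
Qed.
HB.instance Definition _ :=
  GRing.isLinear.Build B {freeg G / B} M *:%R (fglift g) fglift_is_linear.

Lemma fglift_gen x : fglift g << x >> = g x.
Proof. by rewrite liftU scale1r. Qed.

End FreeModule.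

Section Span.
Variables (B : nzRingType) (V : lmodType B) (X : set V).

Definition span : V -> bool := fun v =>
  `[< exists s : seq (B * V),
        (forall p, p \in s -> X p.2) /\ v = \sum_(p <- s) p.1 *: p.2 >].

Lemma span_subproof : subsemimod_closed span.
Proof.
split; first split.
- by apply/asboolP; exists [::]; rewrite big_nil.
- move=> x y /asboolP[s [Xs ->]] /asboolP[t [Xt ->]]; apply/asboolP.
  exists (s ++ t); rewrite big_cat; split=> // p.
  by rewrite mem_cat => /orP[/Xs|/Xt].
- move=> a x /asboolP[s [Xs ->]]; apply/asboolP.
  exists [seq (a * p.1, p.2) | p <- s]; split=> [p /mapP[q /Xs + ->]//|].
  by rewrite big_map scaler_sumr; apply: eq_bigr => p _; rewrite scalerA.
Qed.
HB.instance Definition _ := GRing.isSubmodClosed.Build B V span span_subproof.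

Lemma mem_span v : X v -> v \in span.
Proof.
move=> Xv; apply/asboolP; exists [:: (1, v)]; rewrite big_seq1 scale1r.
by split=> // p; rewrite inE => /eqP->.
Qed.

End Span.

Section QuotientModule.
Variables (B : nzRingType) (V : lmodType B) (X : set V).
Local Open Scope quotient_scope.

Definition quotmod := Quotient.quot (GRing.ZmodClosed.clone V (span X) _).
HB.instance Definition _ := GRing.Zmodule.on quotmod.

Definition qproj (v : V) : quotmod := \pi_quotmod v.

Lemma qproj_is_zmod_morphism : zmod_morphism qproj.
Proof. by move=> x y; rewrite /qproj raddfB. Qed.
HB.instance Definition _ :=
  GRing.isZmodMorphism.Build V quotmod qproj qproj_is_zmod_morphism.

Lemma qproj_repr (x : quotmod) : qproj (repr x) = x.
Proof. exact: reprK. Qed.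

Lemma qproj_eqP u v : reflect (qproj u = qproj v) (u - v \in span X).
Proof. by rewrite Quotient.idealrBE; apply: eqP. Qed.

Definition qscale (a : B) (x : quotmod) : quotmod := qproj (a *: repr x).

Lemma qprojZ a v : qscale a (qproj v) = qproj (a *: v).
Proof.
by apply/qproj_eqP; rewrite -scalerBr rpredZ //; apply/qproj_eqP/qproj_repr.
Qed.

Lemma qscaleA a b x : qscale a (qscale b x) = qscale (a * b) x.
Proof. by rewrite -(qproj_repr x) !qprojZ scalerA. Qed.
Lemma qscale1 : left_id 1 qscale.
Proof. by move=> x; rewrite -(qproj_repr x) qprojZ scale1r. Qed.
Lemma qscaleDr : right_distributive qscale +%R.
Proof.
move=> a x y; rewrite -(qproj_repr x) -(qproj_repr y) -raddfD !qprojZ.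
by rewrite scalerDr raddfD.
Qed.
Lemma qscaleDl x : {morph qscale^~ x : a b / a + b}.
Proof. by move=> a b; rewrite -(qproj_repr x) !qprojZ scalerDl raddfD. Qed.
HB.instance Definition _ :=
  GRing.Zmodule_isLmodule.Build B quotmod qscaleA qscale1 qscaleDr qscaleDl.

Lemma qproj_is_linear : linear qproj.
Proof.
by move=> a u v; rewrite raddfD; congr (_ + _); apply: esym (qprojZ a u).
Qed.
HB.instance Definition _ :=
  GRing.isLinear.Build B V quotmod *:%R qproj qproj_is_linear.

End QuotientModule.

(* The B-module with generators G and relations X.                            *)
Section PresentedModule.
Variables (B : nzRingType) (G : choiceType) (X : set {freeg G / B}).

Definition presmod := quotmod X.
HB.instance Definition _ := GRing.Lmodule.on presmod.

Definition gen (x : G) : presmod := qproj X << x >>.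

Lemma gen_sum (z : presmod) :
  exists s : seq (B * G), z = \sum_(p <- s) p.1 *: gen p.2.
Proof.
rewrite -(qproj_repr z); move: (repr z) => {z} D.
exists [seq (coeff x D, x) | x <- dom D].
rewrite big_map -{1}[D]freeg_sumE [LHS]raddf_sum; apply: eq_bigr => x _ /=.
rewrite -[RHS]linearZ /=; congr qproj.
by apply/eqP/freeg_eqP => y; rewrite coeff_fgscale !coeffU mul1r.
Qed.

(* The linear extension of g; meaningful only if g kills the relations X.     *)
Definition preslift (M : lmodType B) (g : G -> M) (z : presmod) : M :=
  fglift g (repr z).

Section Lift.
Variables (M : lmodType B) (g : G -> M).
Hypothesis gX : forall r, X r -> fglift g r = 0.

Lemma preslift_proj D : preslift g (qproj X D) = fglift g D.
Proof.
have /asboolP[s [Xs]] : repr (qproj X D) - D \in span X.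
  by apply/qproj_eqP; rewrite qproj_repr.
move=> /(congr1 (fglift g)); rewrite raddfB raddf_sum big_seq big1.
  by move/eqP; rewrite subr_eq0 => /eqP.
by move=> p /Xs Xp; rewrite /= linearZ /= gX // scaler0.
Qed.

Lemma preslift_gen x : preslift g (gen x) = g x.
Proof. by rewrite preslift_proj fglift_gen. Qed.

Lemma preslift_is_linear : linear (preslift g).
Proof.
move=> a u v; rewrite -(qproj_repr u) -(qproj_repr v) -linearP.
by rewrite !preslift_proj linearP.
Qed.

End Lift.
End PresentedModule.

Section Kaehler.
Variables (A : comPzRingType) (B : comNzRingType) (f : {rmorphism A -> B}).

Inductive kaehler_rel : {freeg B / B} -> Prop :=
| kaehler_rel_add x y : kaehler_rel (<< x + y >> - << x >> - << y >>)
| kaehler_rel_mul x y : kaehler_rel (<< x * y >> - x *: << y >> - y *: << x >>)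
| kaehler_rel_cst a : kaehler_rel << f a >>.

Definition kaehler := presmod kaehler_rel.
HB.instance Definition _ := GRing.Lmodule.on kaehler.

Definition kd (x : B) : kaehler := gen kaehler_rel x.

Definition derivation (M : lmodType B) (D : B -> M) :=
  [/\ forall x y, D (x + y) = D x + D y,
      forall x y, D (x * y) = x *: D y + y *: D x
    & forall a, D (f a) = 0].

Let kd0 r : kaehler_rel r -> qproj kaehler_rel r = 0.
Proof.
move=> kr; rewrite -[RHS](raddf0 (qproj kaehler_rel)); apply/qproj_eqP.
by rewrite subr0; apply: mem_span.
Qed.

Lemma kd_derivation : derivation kd.
Proof.
split=> [x y|x y|a]; last exact: (kd0 (kaehler_rel_cst a)).
  apply/eqP; rewrite -subr_eq0 opprD addrA; apply/eqP.
  by have := kd0 (kaehler_rel_add x y); rewrite !raddfB.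
apply/eqP; rewrite -subr_eq0 opprD addrA; apply/eqP.
by have := kd0 (kaehler_rel_mul x y); rewrite !raddfB /= !linearZ.
Qed.

Lemma kaehler_sum (z : kaehler) :
  exists s : seq (B * B), z = \sum_(p <- s) p.1 *: kd p.2.
Proof. exact: gen_sum. Qed.

Definition kaehler_lift (M : lmodType B) (D : B -> M) : kaehler -> M :=
  preslift D.

Section Lift.
Variables (M : lmodType B) (D : B -> M).
Hypothesis derD : derivation D.

Let liftX r : kaehler_rel r -> fglift D r = 0.
Proof.
case: derD => DD DM Dc [x y|x y|a].
- by rewrite !raddfB /= !fglift_gen DD; apply: addKB.
- by rewrite !raddfB /= !linearZ /= !fglift_gen DM !scalerN; apply: addKB.
- by rewrite fglift_gen Dc.
Qed.

Lemma kaehler_liftE x : kaehler_lift D (kd x) = D x.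
Proof. exact: preslift_gen. Qed.

Lemma kaehler_lift_is_linear : linear (kaehler_lift D).
Proof. exact: preslift_is_linear. Qed.

End Lift.
End Kaehler.

Section Tensor.
Variables (B : comNzRingType) (M N : lmodType B).

Inductive tensor_rel : {freeg (M * N)%type / B} -> Prop :=
| tensor_rel_addl m m' n :
    tensor_rel (<< (m + m', n) >> - << (m, n) >> - << (m', n) >>)
| tensor_rel_addr m n n' :
    tensor_rel (<< (m, n + n') >> - << (m, n) >> - << (m, n') >>)
| tensor_rel_scalel a m n : tensor_rel (<< (a *: m, n) >> - a *: << (m, n) >>)
| tensor_rel_scaler a m n : tensor_rel (<< (m, a *: n) >> - a *: << (m, n) >>).

Definition tensor := presmod tensor_rel.
HB.instance Definition _ := GRing.Lmodule.on tensor.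

Definition tens (m : M) (n : N) : tensor := gen tensor_rel (m, n).

Let tens0 r : tensor_rel r -> qproj tensor_rel r = 0.
Proof.
move=> kr; rewrite -[RHS](raddf0 (qproj tensor_rel)); apply/qproj_eqP.
by rewrite subr0; apply: mem_span.
Qed.

Lemma tens_bilinear : bilinear_for *:%R *:%R tens.
Proof.
have tZl a m n : tens (a *: m) n = a *: tens m n.
  apply/eqP; rewrite -subr_eq0; apply/eqP.
  by have := tens0 (tensor_rel_scalel a m n); rewrite raddfB /= linearZ.
have tZr a m n : tens m (a *: n) = a *: tens m n.
  apply/eqP; rewrite -subr_eq0; apply/eqP.
  by have := tens0 (tensor_rel_scaler a m n); rewrite raddfB /= linearZ.
split=> [n a m m'|m a n n'] /=.
  rewrite -tZl; apply/eqP; rewrite -subr_eq0 opprD addrA; apply/eqP.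
  by have := tens0 (tensor_rel_addl (a *: m) m' n); rewrite !raddfB.
rewrite -tZr; apply/eqP; rewrite -subr_eq0 opprD addrA; apply/eqP.
by have := tens0 (tensor_rel_addr m (a *: n) n'); rewrite !raddfB.
Qed.
HB.instance Definition _ :=
  bilinear_isBilinear.Build B M N tensor *:%R *:%R tens tens_bilinear.

Lemma tensor_sum (z : tensor) :
  exists s : seq (M * N), z = \sum_(p <- s) tens p.1 p.2.
Proof.
have [s ->] := gen_sum z.
exists [seq (p.1 *: p.2.1, p.2.2) | p <- s]; rewrite big_map.
by apply: eq_bigr => -[a [m n]] _; rewrite /= linearZl_LR.
Qed.

Definition tensor_lift (P : lmodType B) (b : M -> N -> P) : tensor -> P :=
  preslift (fun p => b p.1 p.2).

Section Lift.
Variables (P : lmodType B) (b : M -> N -> P).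
Hypothesis b_bilinear : bilinear_for *:%R *:%R b.

Let liftX r : tensor_rel r -> fglift (fun p => b p.1 p.2) r = 0.
Proof.
pose h := bilinear_isBilinear.Build B M N P *:%R *:%R b b_bilinear.
pose H : {bilinear M -> N -> P} := HB.pack b h.
have HE m n : b m n = H m n by [].
case=> [m m' n|m n n'|a m n|a m n];
  rewrite !raddfB /= ?linearZ /= !fglift_gen /= !HE.
- by rewrite linearDl; apply: addKB.
- by rewrite linearDr; apply: addKB.
- by rewrite linearZl_LR ?scalerN; apply: subrr.
- by rewrite linearZr_LR ?scalerN; apply: subrr.
Qed.

Lemma tensor_liftE m n : tensor_lift b (tens m n) = b m n.
Proof. exact: preslift_gen. Qed.

Lemma tensor_lift_is_linear : linear (tensor_lift b).
Proof. exact: preslift_is_linear. Qed.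

End Lift.
End Tensor.

Definition restr (B C : nzRingType) (i : {rmorphism B -> C})
  (P : lmodType C) : Type := P.

Section RestrictionOfScalars.
Variables (B C : nzRingType) (i : {rmorphism B -> C}) (P : lmodType C).
Local Notation restr := (restr i P).

HB.instance Definition _ := GRing.Zmodule.on restr.

Definition restr_scale (a : B) (x : restr) : restr := i a *: (x : P).

Lemma restr_scaleA a b x :
  restr_scale a (restr_scale b x) = restr_scale (a * b) x.
Proof. by rewrite /restr_scale scalerA rmorphM. Qed.
Lemma restr_scale1 : left_id 1 restr_scale.
Proof. by move=> x; rewrite /restr_scale rmorph1 scale1r. Qed.
Lemma restr_scaleDr : right_distributive restr_scale +%R.
Proof. by move=> a x y; rewrite /restr_scale [LHS]scalerDr. Qed.
Lemma restr_scaleDl x : {morph restr_scale^~ x : a b / a + b}.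
Proof. by move=> a b; rewrite /restr_scale rmorphD [LHS]scalerDl. Qed.
HB.instance Definition _ := GRing.Zmodule_isLmodule.Build B restr
  restr_scaleA restr_scale1 restr_scaleDr restr_scaleDl.

End RestrictionOfScalars.

(* M (x)_B C as a C-module, C acting on the right-hand factor.                *)
Section BaseChange.
Variables (B C : comNzRingType) (i : {rmorphism B -> C}) (M : lmodType B).

Definition bchange : Type := tensor M (restr i C^o).
HB.instance Definition _ := GRing.Zmodule.on bchange.

Definition btens (m : M) (a : C) : bchange := tens m (a : restr i C^o).

Definition bscale (c : C) : bchange -> bchange :=
  tensor_lift (fun (m : M) (a : restr i C^o) =>
    tens m (c * (a : C) : restr i C^o)).

Let bscale_bilinear c : bilinear_for *:%R *:%R
  (fun (m : M) (a : restr i C^o) => tens m (c * (a : C) : restr i C^o)).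
Proof.
split=> [a b m m'|m b a a'] /=; first by rewrite linearPl.
rewrite -linearPr; congr (tens m _).
by rewrite [LHS]mulrDr; congr (_ + _); apply: mulrCA.
Qed.

Lemma bscale_tens c m a : bscale c (btens m a) = btens m (c * a).
Proof. exact: (tensor_liftE (bscale_bilinear c)). Qed.

Lemma bscaleDr : right_distributive bscale +%R.
Proof.
move=> c x y; have := tensor_lift_is_linear (bscale_bilinear c) 1 x y.
by rewrite !scale1r.
Qed.

Lemma bchange_sum (z : bchange) :
  exists s : seq (M * C), z = \sum_(p <- s) btens p.1 p.2.
Proof. exact: (tensor_sum (z : tensor M (restr i C^o))). Qed.

Lemma btensDr m a b : btens m (a + b) = btens m a + btens m b.
Proof. exact: (linearDr (@tens B M (restr i C^o))). Qed.
Lemma btensDl m n a : btens (m + n) a = btens m a + btens n a.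
Proof. exact: (linearDl (@tens B M (restr i C^o))). Qed.
Lemma btensZ b m a : btens (b *: m) a = btens m (i b * a).
Proof.
rewrite /btens linearZl_LR.
exact: esym (linearZr_LR (@tens B M (restr i C^o)) m b a).
Qed.

Lemma bscale0 c : bscale c 0 = 0.
Proof. by apply: (addrI (bscale c 0)); rewrite -bscaleDr !addr0. Qed.

Lemma bchange_ind (Q : bchange -> Prop) :
  Q 0 -> (forall m a, Q (btens m a)) -> (forall x y, Q x -> Q y -> Q (x + y)) ->
  forall z, Q z.
Proof.
move=> Q0 Qt QD z; have [s ->] := bchange_sum z.
by elim/big_ind: _ => [|x y|p _] //; apply: QD.
Qed.

Lemma bscaleA a b x : bscale a (bscale b x) = bscale (a * b) x.
Proof.
elim/bchange_ind: x => [|m c|x y hx hy]; first by rewrite !bscale0.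
  by rewrite !bscale_tens mulrA.
by rewrite !bscaleDr hx hy.
Qed.
Lemma bscale1 : left_id 1 bscale.
Proof.
elim/bchange_ind => [|m c|x y hx hy]; first by rewrite bscale0.
  by rewrite bscale_tens mul1r.
by rewrite bscaleDr hx hy.
Qed.
Lemma bscaleDl x : {morph bscale^~ x : a b / a + b}.
Proof.
move=> a b; elim/bchange_ind: x => [|m c|x y hx hy].
- by rewrite !bscale0 addr0.
- by rewrite !bscale_tens mulrDl btensDr.
- by rewrite !bscaleDr hx hy addrACA.
Qed.
HB.instance Definition _ := GRing.Zmodule_isLmodule.Build C bchange
  bscaleA bscale1 bscaleDr bscaleDl.

End BaseChange.

Section Psi.
Variables (A : comPzRingType) (K L : comNzRingType).
Variables (f : {rmorphism A -> K}) (i : {rmorphism K -> L}).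

Definition kaehler_map : kaehler f -> restr i (kaehler (i \o f)) :=
  kaehler_lift (fun x => kd (i \o f) (i x) : restr i (kaehler (i \o f))).

(* The L-linear map dx (x) a |-> a d(i x); see psi_tens and kaehler_mapE.      *)
Definition psi : bchange i (kaehler f) -> kaehler (i \o f) :=
  @tensor_lift K (kaehler f) (restr i L^o) (restr i (kaehler (i \o f)))
    (fun m a => (a : L) *: (kaehler_map m : kaehler (i \o f))).

Let derK : derivation f
  (fun x => kd (i \o f) (i x) : restr i (kaehler (i \o f))).
Proof.
have [DD DM Dc] := kd_derivation (i \o f).
split=> [x y|x y|a]; rewrite ?rmorphD ?rmorphM; [exact: DD|exact: DM|exact: Dc].
Qed.

Lemma kaehler_map_is_linear : linear kaehler_map.
Proof. exact: kaehler_lift_is_linear derK. Qed.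
HB.instance Definition _ := GRing.isLinear.Build K (kaehler f)
  (restr i (kaehler (i \o f))) *:%R kaehler_map kaehler_map_is_linear.

Lemma kaehler_mapE x : kaehler_map (kd f x) = kd (i \o f) (i x).
Proof. exact: kaehler_liftE derK _. Qed.

Let psi_bilinear : @bilinear_for K (kaehler f) (restr i L^o)
  (restr i (kaehler (i \o f))) *:%R *:%R
  (fun m a => (a : L) *: (kaehler_map m : kaehler (i \o f))).
Proof.
split=> [a b m m'|m b a a'] /=.
  rewrite linearP [LHS]scalerDr; congr (_ + _).
  by rewrite [LHS]scalerA mulrC -scalerA.
by rewrite [LHS]scalerDl -scalerA.
Qed.

Lemma psi_tens m a : psi (btens i m a) = a *: (kaehler_map m : kaehler _).
Proof. exact: (tensor_liftE psi_bilinear). Qed.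

Lemma psi_is_linear : linear psi.
Proof.
have psiD x y : psi (x + y) = psi x + psi y.
  have := tensor_lift_is_linear psi_bilinear 1 x y.
  by rewrite !scale1r.
have psi0 : psi 0 = 0 by apply: (addrI (psi 0)); rewrite -psiD !addr0.
move=> c x y; rewrite psiD; congr (_ + _).
elim/bchange_ind: x => [|m a|u v hu hv]; first by rewrite scaler0 psi0 scaler0.
  by rewrite [c *: _]bscale_tens !psi_tens scalerA.
by rewrite scalerDr !psiD hu hv scalerDr.
Qed.
HB.instance Definition _ := GRing.isLinear.Build L
  (bchange i (kaehler f)) (kaehler (i \o f)) *:%R psi psi_is_linear.

End Psi.

(* Non-archimedean real valuations, written multiplicatively; v x = 0 only    *)
(* for x = 0, by val1 and valM.                                               *)
Record valuation (R : realType) (K : fieldType) := Valuation {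
  val_fun :> K -> R;
  val_ge0 : forall x, 0 <= val_fun x;
  val0 : val_fun 0 = 0;
  val1 : val_fun 1 = 1;
  valM : forall x y, val_fun (x * y) = val_fun x * val_fun y;
  valD : forall x y, val_fun (x + y) <= Num.max (val_fun x) (val_fun y)
}.

(* By kaehler_sum and bchange_sum the two infima below are over nonempty sets. *)
Definition kaehler_seminorm (R : realType) (A : comPzRingType) (K : fieldType)
    (v : valuation R K) (f : {rmorphism A -> K}) (x : kaehler f) : R :=
  inf [set t | exists s : seq (K * K),
    x = \sum_(p <- s) p.1 *: kd f p.2 /\
    t = \big[Num.max/0]_(p <- s) (v p.1 * v p.2)].

Definition tensor_seminorm (R : realType) (K L : fieldType)
    (i : {rmorphism K -> L}) (M : lmodType K) (N : M -> R) (v : valuation R L)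
    (z : bchange i M) : R :=
  inf [set t | exists s : seq (M * L),
    z = \sum_(p <- s) btens i p.1 p.2 /\
    t = \big[Num.max/0]_(p <- s) (N p.1 * v p.2)].

Arguments psi {A K L} f i z.
Arguments kaehler_seminorm {R A K} v f x.
Arguments tensor_seminorm {R K L} i {M} N v z.

(* V with the topology whose neighbourhoods of x are generated by the N-balls *)
(* centered at x.                                                             *)
Definition seminormed (R : realType) (V : zmodType) (N : V -> R) : Type := V.

Section SeminormTopology.
Variables (R : realType) (V : zmodType) (N : V -> R).
Local Notation seminormed := (seminormed N).

HB.instance Definition _ := GRing.Zmodule.on seminormed.

Definition seminorm_open (U : set V) :=
  forall x, U x -> exists2 e : R, 0 < e & forall y, N (y - x) < e -> U y.

Let openT : seminorm_open setT.
Proof. by move=> x _; exists 1. Qed.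
Let openI : setI_closed seminorm_open.
Proof.
move=> U W oU oW x [/oU[e e0 Ue] /oW[d d0 Wd]].
exists (Num.min e d); first by rewrite lt_min e0.
by move=> y; rewrite lt_min => /andP[/Ue ? /Wd].
Qed.
Let open_bigU (I : Type) (F : I -> set V) :
  (forall j, seminorm_open (F j)) -> seminorm_open (\bigcup_j F j).
Proof.
move=> oF x [j _ /oF[e e0 Fe]]; exists e => // y /Fe Fy.
by exists j.
Qed.
HB.instance Definition _ :=
  isOpenTopological.Build seminormed openT openI open_bigU.

Lemma seminorm_openE (U : set seminormed) : open U = seminorm_open U.
Proof. by []. Qed.

End SeminormTopology.

(* Main.v *)
(* The derivation d : K -> Omega_{K/A} (x) L satisfies |d b| <= |b|, so by    *)
(* density it extends by continuity to a derivation from L to the completion  *)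
(* of Omega_{K/A} (x) L, hence to a map on Omega_{L/A} sending c d(b) to an   *)
(* element of seminorm at most |c| |b|. Composed with psi this is the         *)
(* canonical map to the completion, which is isometric; as psi does not       *)
(* increase seminorms, it is an isometry. Its image is dense because          *)
(* |d b - d b'| <= |b - b'|.                                                  *)
From HB Require Import structures.
Require Import Defs.
From mathcomp Require Import all_boot all_order ssralg ssrnum.
From mathcomp Require Import boolp classical_sets reals topology.
From mathcomp Require Import functions interval_inference normedtype.
From mathcomp Require Import ring.

Set Implicit Arguments.
Unset Strict Implicit.
Unset Printing Implicit Defensive.

Import Order.TTheory GRing.Theory Num.Theory.
Local Open Scope ring_scope.
Local Open Scope classical_set_scope.

(** That [psi] does not increase seminorms ([psi_le]) is checked on generators: an infimum over
    representations is the largest ultrametric function bounded by the weights of the generators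
    ([repnorm_universal]). For the reverse inequality ([psi_ge]), let phi_n(b) in K tend to b.
    Modulo null sequences, b |-> d(phi_n b) (x) 1 is a derivation of L ([limit_d_derivation]), and
    its lift to Omega_{L/A}, composed with [psi], sends z to the constant sequence z ([lift_psi]).
    So a representation psi z = sum_j c_j d(b_j) exhibits z as the limit of u_n = sum_j c_j (d(phi_n
    b_j) (x) 1). If all |c_j| |b_j| < |z|, then |u_n| < |z| for large n, which contradicts z - u_n
    -> 0. All sequences modulo null ones replace the completion: only equality of classes is used,
    not a norm on them. *)

(** * Seminorms defined by representations *)

Section RepresentationNorm.
Variables (R : realType) (V : zmodType) (P : eqType) (e : P -> V) (w : P -> R).
Hypothesis w_ge0 : forall p, 0 <= w p.
Hypothesis e_gen : forall x, exists s : seq P, x = \sum_(p <- s) e p.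

Definition repnorm (x : V) : R :=
  inf [set t | exists s : seq P,
    x = \sum_(p <- s) e p /\ t = \big[Num.max/0]_(p <- s) w p].

Let maxw_ge0 (s : seq P) : 0 <= \big[Num.max/0]_(p <- s) w p.
Proof. by elim/big_ind: _ => // x y x0 y0; rewrite le_max x0. Qed.

Let maxw_lt (s : seq P) r :
  0 < r -> (forall p, p \in s -> w p < r) -> \big[Num.max/0]_(p <- s) w p < r.
Proof.
move=> r0 sr; rewrite big_seq; elim/big_ind: _ => // x y xr yr.
by rewrite gt_max xr.
Qed.

Let le_maxw (s : seq P) p : p \in s -> w p <= \big[Num.max/0]_(p <- s) w p.
Proof.
elim: s => // a s IHs; rewrite inE big_cons le_max => /orP[/eqP->|/IHs->].
  by rewrite lexx.
by rewrite orbT.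
Qed.

Lemma repnorm_ge0 x : 0 <= repnorm x.
Proof.
apply: lb_le_inf => [|t [s [_ ->]]//].
by have [s xs] := e_gen x; exists (\big[Num.max/0]_(p <- s) w p), s.
Qed.

(** Trades the infimum for one good representation. The maximum over an empty representation is 0,
    hence the condition 0 < r. *)
Lemma repnorm_lt x r : 0 < r ->
  repnorm x < r <->
  exists2 s : seq P, x = \sum_(p <- s) e p & forall p, p \in s -> w p < r.
Proof.
move=> r0; split=> [|[s xs sr]].
  move=> /inf_lt[|t [s [xs ->]] sr].
    by have [s xs] := e_gen x; exists (\big[Num.max/0]_(p <- s) w p), s.
  by exists s => // p /le_maxw/le_lt_trans; apply.
apply: le_lt_trans (maxw_lt r0 sr); apply: ge_inf; last by exists s.
by exists 0 => t [s' [_ ->]].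
Qed.

Lemma repnorm_gen p : repnorm (e p) <= w p.
Proof.
apply/ler_addgt0Pr => c c0; apply/ltW/repnorm_lt; first by rewrite ltr_wpDl.
exists [:: p]; first by rewrite big_seq1.
by move=> q; rewrite inE => /eqP->; rewrite ltrDl.
Qed.

Lemma repnormD x y : repnorm (x + y) <= Num.max (repnorm x) (repnorm y).
Proof.
(* Otherwise x and y have representations with all weights below the seminorm of x + y, and so does
   x + y by concatenation. *)
rewrite leNgt gt_max; apply/negP => /andP[xr yr].
have r0 := le_lt_trans (repnorm_ge0 x) xr.
have /repnorm_lt-/(_ r0)[s xs sr] := xr.
have /repnorm_lt-/(_ r0)[t yt tr] := yr.
suff : repnorm (x + y) < repnorm (x + y) by rewrite ltxx.
apply/repnorm_lt => //; exists (s ++ t); first by rewrite big_cat -xs -yt.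
by move=> p; rewrite mem_cat => /orP[/sr|/tr].
Qed.

(** Estimate q along a nearly optimal representation. The factor C serves for scalar multiplication,
    where q x is the seminorm of c x and C = |c|. *)
Lemma repnorm_universal (q : V -> R) C : 0 <= C -> q 0 <= 0 ->
    (forall x y, q (x + y) <= Num.max (q x) (q y)) ->
    (forall p, q (e p) <= C * w p) ->
  forall x, q x <= C * repnorm x.
Proof.
move=> C0 q0 qD qe x; apply/ler_addgt0Pr => c c0.
(* This slack, multiplied by C, is at most c, also when C = 0. *)
have d0 : 0 < c / (C + 1) by rewrite divr_gt0 // ltr_wpDl.
have r0 : 0 < repnorm x + c / (C + 1) by rewrite ltr_wpDl // repnorm_ge0.
have [s xs sr] : exists2 s, x = \sum_(p <- s) e p &
    forall p, p \in s -> w p < repnorm x + c / (C + 1).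
  by apply/repnorm_lt => //; rewrite ltrDl.
apply: (@le_trans _ _ (C * (repnorm x + c / (C + 1)))); last first.
  rewrite mulrDr lerD2l mulrCA ger_pMr // ler_pdivrMr ?ltr_wpDl //.
  by rewrite mul1r lerDl.
rewrite [in q x]xs big_seq; elim/big_ind: _ => [|y z yr zr|p /sr /ltW pr].
- by apply: le_trans q0 _; rewrite mulr_ge0 // ltW.
- by apply: le_trans (qD _ _) _; rewrite ge_max yr.
- by apply: le_trans (qe p) _; rewrite ler_wpM2l.
Qed.

End RepresentationNorm.

(** * Seminormed modules: density and null sequences *)

Section ModuleSeminorm.
Variables (R : realType) (F : fieldType) (v : valuation R F).

Definition module_seminorm (V : lmodType F) (N : V -> R) :=
  [/\ forall x, 0 <= N x,
      forall x y, N (x + y) <= Num.max (N x) (N y)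
    & forall c x, N (c *: x) <= v c * N x].

Lemma valuation_seminorm : @module_seminorm F^o v.
Proof.
by split=> [x|x y|c x]; [apply: val_ge0|apply: Defs.valD|rewrite -Defs.valM].
Qed.

Lemma repnorm_seminorm (V : lmodType F) (P : eqType) (e : P -> V) (w : P -> R) :
    (forall p, 0 <= w p) ->
    (forall x, exists s : seq P, x = \sum_(p <- s) e p) ->
    (forall c p, exists2 p', c *: e p = e p' & w p' <= v c * w p) ->
  module_seminorm (repnorm e w).
Proof.
move=> w0 eg eZ; have ND := repnormD w0 eg; have N0 := repnorm_ge0 w0 eg.
split=> // c x.
apply: (repnorm_universal w0 eg (q := fun x => repnorm e w (c *: x))) => //.
- exact: val_ge0.
- rewrite scaler0; apply/ler_addgt0Pr => d d0; rewrite add0r.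
  by apply/ltW/repnorm_lt => //; exists [::]; rewrite ?big_nil.
- by move=> y z; rewrite scalerDr.
- by move=> p; have [p' -> /(le_trans _)] := eZ c p; apply; apply: repnorm_gen.
Qed.

Section Theory.
Variables (V : lmodType F) (N : V -> R).
Hypothesis seminormN : module_seminorm N.
Let N_ge0 x : 0 <= N x. Proof. by case: seminormN. Qed.
Let ND x y : N (x + y) <= Num.max (N x) (N y). Proof. by case: seminormN. Qed.
Let NZ c x : N (c *: x) <= v c * N x. Proof. by case: seminormN. Qed.

Lemma seminorm_0 : N 0 = 0.
Proof.
apply/eqP; rewrite eq_le N_ge0 andbT.
rewrite -(scale0r (0 : V)); apply: le_trans (NZ _ _) _.
by rewrite Defs.val0 mul0r.
Qed.

Lemma denseP (S : set (seminormed N)) :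
  dense S <-> forall x e, 0 < e -> exists2 y, S y & N (y - x) < e.
Proof.
split=> [dS x e e0|dS O [x Ox] oO].
  have [||y [xy Sy]] := dS [set y | N (y - x) < e].
  - by exists x => /=; rewrite subrr seminorm_0.
  - rewrite seminorm_openE => y yx; rewrite /= in yx; exists e => // z zy /=.
    rewrite -(subrK (y : V) z) -addrA (le_lt_trans (ND _ _)) // gt_max.
    by rewrite zy yx.
  by exists y.
have [e e0 xeO] : exists2 e, 0 < e & forall y, N (y - x) < e -> O y.
  exact: (oO : seminorm_open N O).
by have [y Sy yx] := dS x e e0; exists y; split=> //; apply: xeO.
Qed.

Definition null (u : nat -> V) :=
  forall e, 0 < e -> \forall n \near \oo, N (u n) < e.

Lemma null0 : null 0.
Proof.
by move=> e e0; near=> n; rewrite seminorm_0.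
Unshelve. all: by end_near. Qed.

Lemma nullD u w : null u -> null w -> null (u + w).
Proof.
move=> nu nw e e0; near=> n; apply: le_lt_trans (ND _ _) _; rewrite gt_max.
by apply/andP; split; near: n; [apply: nu|apply: nw].
Unshelve. all: by end_near. Qed.

(** For the Leibniz rule: a_n is an error phi_n x - x and u_n is bounded. *)
Lemma null_scale (a : nat -> F) u C : 0 <= C ->
    (forall e, 0 < e -> \forall n \near \oo, v (a n) < e) ->
    (\forall n \near \oo, N (u n) <= C) ->
  null (fun n => a n *: u n).
Proof.
move=> C0 na uC e e0; have C1 : 0 < C + 1 by rewrite ltr_wpDl.
have eC0 : 0 < e / (C + 1) by rewrite divr_gt0.
near=> n.
have nC : N (u n) <= C by near: n.
have an : v (a n) < e / (C + 1) by near: n; apply: na.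
apply: le_lt_trans (NZ _ _) _.
rewrite ltr_pdivlMr // in an; apply: le_lt_trans an.
by rewrite ler_wpM2l ?val_ge0 // (le_trans nC) // lerDl.
Unshelve. all: by end_near. Qed.

Lemma nullZ c u : null u -> null (c *: u).
Proof.
move=> nu e e0; have c1 : 0 < v c + 1 by rewrite ltr_wpDl // val_ge0.
have ec0 : 0 < e / (v c + 1) by rewrite divr_gt0.
near=> n; have un : N (u n) < e / (v c + 1) by near: n; apply: nu.
apply: le_lt_trans (NZ _ _) _.
rewrite ltr_pdivlMr // mulrC in un; apply: le_lt_trans un.
by rewrite ler_wpM2r // lerDl.
Unshelve. all: by end_near. Qed.

Lemma nullB u w : null u -> null w -> null (u - w).
Proof.
by move=> nu nw; apply: nullD => //; rewrite -scaleN1r; apply: nullZ.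
Qed.

(** [quotmod] divides by a span; null sequences already form a submodule, so the span adds
    nothing. *)
Lemma null_span u : u \in span null -> null u.
Proof.
move=> /asboolP[s [ns ->]]; rewrite big_seq.
by elim/big_ind: _ => [|x y|p /ns/nullZ]; [exact: null0|exact: nullD|].
Qed.

Lemma qproj_nullP u w : qproj null u = qproj null w <-> null (u - w).
Proof.
split=> [/qproj_eqP/null_span//|nuw].
exact/qproj_eqP/mem_span.
Qed.

End Theory.
End ModuleSeminorm.

(** * The Kähler seminorm as a representation seminorm *)

Section KaehlerSeminorm.
Variables (R : realType) (A : comPzRingType) (K : fieldType).
Variables (v : valuation R K) (f : {rmorphism A -> K}).
Local Notation N := (kaehler_seminorm v f).

Let w_ge0 (p : K * K) : 0 <= v p.1 * v p.2.
Proof. by rewrite mulr_ge0 ?val_ge0. Qed.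

Lemma kaehler_seminormP : module_seminorm v N.
Proof.
apply: repnorm_seminorm => // [x|c p]; first exact: kaehler_sum.
by exists (c * p.1, p.2); rewrite ?scalerA //= Defs.valM mulrA.
Qed.

Lemma kaehler_seminorm_kd b : N (kd f b) <= v b.
Proof.
have /= := repnorm_gen (e := fun p : K * K => p.1 *: kd f p.2) w_ge0
  (@kaehler_sum _ _ f) (1, b).
by rewrite scale1r Defs.val1 mul1r.
Qed.

Lemma kaehler_seminorm_lt x r : 0 < r ->
  N x < r <->
  exists2 s : seq (K * K), x = \sum_(p <- s) p.1 *: kd f p.2 &
    forall p, p \in s -> v p.1 * v p.2 < r.
Proof. by apply: repnorm_lt => // y; apply: kaehler_sum. Qed.

Lemma kaehler_seminorm_universal (q : kaehler f -> R) : q 0 <= 0 ->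
    (forall x y, q (x + y) <= Num.max (q x) (q y)) ->
    (forall c b, q (c *: kd f b) <= v c * v b) ->
  forall x, q x <= N x.
Proof.
move=> q0 qD qe x; rewrite -[leRHS]mul1r.
apply: (repnorm_universal w_ge0) => // [y|p]; first exact: kaehler_sum.
by rewrite mul1r.
Qed.

End KaehlerSeminorm.

(** * The tensor seminorm as a representation seminorm *)

Section TensorSeminorm.
Variables (R : realType) (K L : fieldType) (i : {rmorphism K -> L}).
Variables (vK : valuation R K) (v : valuation R L).
Variables (M : lmodType K) (N : M -> R).
Hypothesis seminormN : module_seminorm vK N.
Local Notation T := (tensor_seminorm i N v).

Let w_ge0 (p : M * L) : 0 <= N p.1 * v p.2.
Proof. by case: seminormN => N0 _ _; rewrite mulr_ge0 ?val_ge0. Qed.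

Lemma tensor_seminormP : module_seminorm v T.
Proof.
apply: repnorm_seminorm => // [x|c p]; first exact: bchange_sum.
exists (p.1, c * p.2); first exact: bscale_tens.
by rewrite /= Defs.valM mulrCA.
Qed.

Lemma tensor_seminorm_btens m a : T (btens i m a) <= N m * v a.
Proof.
exact: (repnorm_gen (e := fun p : M * L => btens i p.1 p.2) w_ge0
  (@bchange_sum _ _ i M) (m, a)).
Qed.

Lemma tensor_seminorm_universal (q : bchange i M -> R) : q 0 <= 0 ->
    (forall x y, q (x + y) <= Num.max (q x) (q y)) ->
    (forall m a, q (btens i m a) <= N m * v a) ->
  forall x, q x <= T x.
Proof.
move=> q0 qD qe x; rewrite -[leRHS]mul1r.
apply: (repnorm_universal w_ge0) => // [y|p]; first exact: bchange_sum.
by rewrite mul1r.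
Qed.

End TensorSeminorm.

Lemma btens0l (K L : comNzRingType) (i : {rmorphism K -> L}) (M : lmodType K)
    (a : L) : btens i (0 : M) a = 0.
Proof. by apply: (addIr (btens i 0 a)); rewrite -btensDl !add0r. Qed.

(** * The map [psi] and the derivation of K into the tensor product *)

Section DenseExtension.
Variables (R : realType) (A : comPzRingType) (K L : fieldType).
Variables (vK : valuation R K) (vL : valuation R L).
Variables (i : {rmorphism K -> L}) (f : {rmorphism A -> K}).
Hypothesis i_ext : forall x : K, vL (i x) = vK x.
Local Notation NK := (kaehler_seminorm vK f).
Local Notation NL := (kaehler_seminorm vL (i \o f)).
Local Notation NT := (tensor_seminorm i NK vL).
Local Notation T := (bchange i (kaehler f)).

Let NTP : module_seminorm vL NT :=
  tensor_seminormP i vL (kaehler_seminormP vK f).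
Let NLP : module_seminorm vL NL := kaehler_seminormP vL (i \o f).

Lemma psi_le z : NL (psi f i z) <= NT z.
Proof.
have [NL0 NLD NLZ] := NLP.
apply: (tensor_seminorm_universal (kaehler_seminormP vK f)
  (q := fun z => NL (psi f i z))) => [|x y|m a].
- by rewrite raddf0 (seminorm_0 NLP).
- by rewrite raddfD.
rewrite psi_tens; apply: le_trans (NLZ _ _) _.
rewrite mulrC ler_wpM2r ?val_ge0 //.
apply: (kaehler_seminorm_universal (q := fun m => NL (kaehler_map i m))).
- by rewrite raddf0 (seminorm_0 NLP).
- by move=> x y; rewrite raddfD.
move=> c b; rewrite linearZ /= kaehler_mapE.
apply: le_trans (NLZ _ _) _; rewrite i_ext ler_wpM2l ?val_ge0 //.
by rewrite -i_ext; apply: kaehler_seminorm_kd.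
Qed.

(** The A-derivation of K that is to be extended to L by continuity. *)
Definition btens_kd (k : K) : T := btens i (kd f k) 1.

Lemma btens_kdD : {morph btens_kd : x y / x + y}.
Proof.
move=> x y; rewrite /btens_kd; have [-> _ _] := kd_derivation f.
exact: btensDl.
Qed.

Lemma btens_kdM x y :
  btens_kd (x * y) = i x *: btens_kd y + i y *: btens_kd x.
Proof.
rewrite /btens_kd; have [_ -> _] := kd_derivation f.
by rewrite btensDl !btensZ [_ *: _]bscale_tens [i y *: _]bscale_tens.
Qed.

Lemma btens_kd_cst a : btens_kd (f a) = 0.
Proof.
rewrite /btens_kd; have [_ _ ->] := kd_derivation f.
exact: btens0l.
Qed.

Lemma btens_kdB : {morph btens_kd : x y / x - y}.
Proof.
move=> x y; apply: (addIr (btens_kd y)).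
by rewrite subrK -btens_kdD subrK.
Qed.

Lemma btens_kd_le k : NT (btens_kd k) <= vL (i k).
Proof.
apply: le_trans (tensor_seminorm_btens i vL (kaehler_seminormP vK f) _ _) _.
by rewrite Defs.val1 mulr1 i_ext kaehler_seminorm_kd.
Qed.

Lemma btens_kd_ind (Q : T -> Prop) :
    (forall x y, Q x -> Q y -> Q (x + y)) ->
    (forall a k, Q (a *: btens_kd k)) ->
  forall z, Q z.
Proof.
move=> QD Qe; have Q0 : Q 0 by rewrite -(scale0r (btens_kd 0)).
elim/bchange_ind => // m a; have [s ->] := kaehler_sum m.
elim: s => [|p s IHs]; first by rewrite big_nil btens0l.
rewrite big_cons btensDl; apply: QD => //.
by rewrite btensZ -[_ * _]mulr1 -bscale_tens; apply: Qe.
Qed.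

(** * Extension of the derivation to L modulo null sequences *)

Section Completion.
Variable phi : nat -> L -> K.
Hypothesis phi_lim :
  forall b : L, null (V := L^o) vL (fun n => i (phi n b) - b).

Let VP : module_seminorm vL (vL : L^o -> R) := valuation_seminorm vL.

Lemma null_btens_kd (k : nat -> K) :
  null (V := L^o) vL (i \o k) -> null NT (btens_kd \o k).
Proof.
move=> nk e e0; near=> n; apply: le_lt_trans (btens_kd_le _) _.
by near: n; apply: nk.
Unshelve. all: by end_near. Qed.

(** The 1 bounds |phi_n b - b| for large n. *)
Lemma phi_bounded (b : L) :
  \forall n \near \oo, vL (i (phi n b)) <= Num.max (vL b) 1.
Proof.
near=> n; rewrite -[i _](subrK b); apply: le_trans (Defs.valD _ _ _) _.
rewrite ge_max !le_max lexx andbT orbC ltW //.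
by near: n; apply: phi_lim.
Unshelve. all: by end_near. Qed.

(* The limit of d (phi n b) (x) 1, in sequences modulo null sequences, into   *)
(* which the completion of Omega_{K/A} (x) L embeds.                          *)
Definition limit_d (b : L) : quotmod (null NT) :=
  qproj (null NT) (fun n => btens_kd (phi n b)).

(** Each rule holds up to d of an element of K tending to 0, as phi_n(x + y) - phi_n x - phi_n y
    does, and d does not increase absolute values. *)
Lemma limit_d_derivation : derivation (i \o f) limit_d.
Proof.
split=> [x y|x y|a]; rewrite /limit_d.
- rewrite -raddfD; apply/(qproj_nullP NTP).
  have -> : (fun n => btens_kd (phi n (x + y))) -
      ((fun n => btens_kd (phi n x)) + (fun n => btens_kd (phi n y))) =
      btens_kd \o (fun n => phi n (x + y) - (phi n x + phi n y)).
    by apply/funext => n; rewrite /= btens_kdB btens_kdD.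
  apply: null_btens_kd.
  have := nullB VP (phi_lim (x + y)) (nullD VP (phi_lim x) (phi_lim y)).
  by congr null; apply/funext => n; rewrite /= !fctE rmorphB rmorphD; ring.
- rewrite -!linearZ -raddfD; apply/(qproj_nullP NTP).
  (* Expanding d(phi_n x phi_n y) splits the Leibniz defect into d(phi_n(xy) - phi_n x phi_n y) and
     two products of a null and a bounded sequence. *)
  pose xn n := i (phi n x) - x; pose yn n := i (phi n y) - y.
  have -> : (fun n => btens_kd (phi n (x * y))) -
      (x *: (fun n => btens_kd (phi n y)) +
       y *: (fun n => btens_kd (phi n x))) =
      btens_kd \o (fun n => phi n (x * y) - phi n x * phi n y) +
      ((fun n => xn n *: btens_kd (phi n y)) +
       (fun n => yn n *: btens_kd (phi n x))).
    apply/funext => n; rewrite !fctE /= btens_kdB btens_kdM /xn /yn !scalerBl.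
    by rewrite [X in _ = _ + X]addrACA -opprD addrA subrK.
  apply: (nullD NTP); [apply: null_btens_kd|apply: (nullD NTP)].
  (* phi_n x phi_n y - xy = (phi_n x - x) phi_n y + x (phi_n y - y). *)
  + have xyn : null (V := L^o) vL (fun n => xn n *: (i (phi n y) : L^o)).
      by apply: (null_scale VP _ (phi_lim x) (phi_bounded y));
        rewrite le_max ler01 orbT.
    have := nullB VP (phi_lim (x * y)) (nullD VP xyn (nullZ VP x (phi_lim y))).
    congr null; apply/funext => n; rewrite /= !fctE rmorphB rmorphM /xn.
    by rewrite /GRing.scale /=; ring.
  + apply: (null_scale NTP (C := Num.max (vL y) 1) _ (phi_lim x)).
      by rewrite le_max ler01 orbT.
    by apply: filterS (phi_bounded y) => n; apply: le_trans (btens_kd_le _).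
  + apply: (null_scale NTP (C := Num.max (vL x) 1) _ (phi_lim y)).
      by rewrite le_max ler01 orbT.
    by apply: filterS (phi_bounded x) => n; apply: le_trans (btens_kd_le _).
- rewrite -(raddf0 (qproj (null NT))); apply/(qproj_nullP NTP); rewrite subr0.
  have -> : (fun n => btens_kd (phi n ((i \o f) a))) =
      btens_kd \o (fun n => phi n (i (f a)) - f a).
    by apply/funext => n; rewrite /= btens_kdB btens_kd_cst subr0.
  apply: null_btens_kd; have := phi_lim (i (f a)).
  by congr null; apply/funext => n; rewrite /= rmorphB.
Qed.

Let lift_linear := kaehler_lift_is_linear limit_d_derivation.
HB.instance Definition _ := GRing.isLinear.Build L (kaehler (i \o f))
  (quotmod (null NT)) *:%R (kaehler_lift limit_d) lift_linear.

(** On a generator a (d k (x) 1) with k in K, this amounts to d(phi_n k - k) -> 0. *)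
Lemma lift_psi z :
  kaehler_lift limit_d (psi f i z) = qproj (null NT) (fun=> z).
Proof.
elim/btens_kd_ind: z => [x y hx hy|a k].
  by rewrite !raddfD /= hx hy -raddfD.
rewrite linearZ linearZ /= /btens_kd psi_tens scale1r kaehler_mapE.
rewrite kaehler_liftE; last exact: limit_d_derivation.
rewrite /limit_d -linearZ; apply/(qproj_nullP NTP).
have -> : a *: (fun n => btens_kd (phi n (i k))) -
    (fun=> a *: btens i (kd f k) 1) =
    a *: (btens_kd \o (fun n => phi n (i k) - k)).
  by apply/funext => n; rewrite !fctE /= btens_kdB scalerBr.
apply: (nullZ NTP); apply: null_btens_kd; have := phi_lim (i k).
by congr null; apply/funext => n; rewrite /= rmorphB.
Qed.

Lemma psi_ge z : NT z <= NL (psi f i z).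
Proof.
have [NL0 _ _] := NLP; have [_ NTD NTZ] := NTP.
rewrite leNgt; apply/negP => zr; have r0 := le_lt_trans (NL0 _) zr.
have /kaehler_seminorm_lt-/(_ r0)[s psi_z sr] := zr.
(* Each d b in the representation of psi z is replaced by d(phi_n b) (x) 1. *)
pose u : nat -> T := \sum_(p <- s) p.1 *: (fun n => btens_kd (phi n p.2)).
have zu : null NT ((fun=> z) - u).
  apply/(qproj_nullP NTP); rewrite -lift_psi psi_z /u !raddf_sum.
  apply: eq_bigr => p _; rewrite /= !linearZ /= kaehler_liftE //.
  exact: limit_d_derivation.
have ur : \forall n \near \oo, NT (u n) < NT z.
  rewrite /u big_seq; elim/big_ind: _ => [|x y xr yr|[c b] /sr /= cb].
  - by near=> n; rewrite (seminorm_0 NTP).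
  - near=> n; apply: le_lt_trans (NTD _ _) _; rewrite gt_max.
    by apply/andP; split; near: n.
  (* Once |phi_n b - b| < |z| / (|c| + 1), both |c| |phi_n b - b| and |c| |b| are below |z|; adding
     1 covers c = 0. *)
  have c1 : 0 < vL c + 1 by rewrite ltr_wpDl // val_ge0.
  have rc : 0 < NT z / (vL c + 1) by rewrite divr_gt0.
  near=> n; apply: le_lt_trans (NTZ _ _) _.
  apply: (@le_lt_trans _ _ (vL c * vL (i (phi n b)))).
    by rewrite ler_wpM2l ?val_ge0 // btens_kd_le.
  have bn : vL (i (phi n b) - b) < NT z / (vL c + 1).
    by near: n; apply: phi_lim.
  rewrite -[i _](subrK b).
  apply: (@le_lt_trans _ _ (vL c * Num.max (vL (i (phi n b) - b)) (vL b))).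
    by rewrite ler_wpM2l ?val_ge0 // Defs.valD.
  rewrite maxr_pMr ?val_ge0 // gt_max cb andbT.
  rewrite ltr_pdivlMr // mulrC in bn; apply: le_lt_trans bn.
  by rewrite ler_wpM2r ?val_ge0 // lerDl.
suff : \forall n \near \oo, False by move=> [n _ /(_ n (leqnn n))].
near=> n; suff : NT z < NT z by rewrite ltxx.
rewrite -{1}(subrK (u n) z); apply: le_lt_trans (NTD _ _) _; rewrite gt_max.
by apply/andP; split; near: n; [apply: zu|].
Unshelve. all: by end_near. Qed.

End Completion.

(** * Consequences of density *)

Hypothesis K_dense : dense (range i : set (seminormed vL)).

Let approx b e : 0 < e -> exists k, vL (i k - b) < e.
Proof.
move=> e0; have /(denseP (valuation_seminorm vL)) iK := K_dense.
by have [_ [k _ <-] kb] := iK b e e0; exists k.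
Qed.

Lemma psi_isometry z : NL (psi f i z) = NT z.
Proof.
apply/eqP; rewrite eq_le psi_le /=.
(* The error 1/(n+1) is uniform in b, so one choice of phi serves all of L. *)
have /choice[phi phiP] (n : nat) : exists g : L -> K,
    forall b, vL (i (g b) - b) < n.+1%:R^-1.
  have n0 : (0 : R) < n.+1%:R^-1 by rewrite invr_gt0.
  by have /choice[g gP] (b : L) := approx b n0; exists g.
apply: (psi_ge (phi := phi)) => b e e0; near=> n.
apply: lt_trans (phiP n b) _.
by near: n; apply: near_infty_natSinv_lt (PosNum e0).
Unshelve. all: by end_near. Qed.

(** Replacing b by k in K moves c d(b) by at most |c| |k - b|, and finite sums follow by the
    ultrametric inequality. *)
Lemma psi_dense : dense (range (psi f i) : set (seminormed NL)).
Proof.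
apply/(denseP NLP) => x; have [_ NLD NLZ] := NLP.
suff H e : 0 < e -> exists z, NL (psi f i z - x) < e.
  by move=> e /H[z zx]; exists (psi f i z).
move=> e0; have [s ->] := kaehler_sum x.
elim/big_ind: _ => [|y y' [z zy] [z' zy']|[c b] _].
- by exists 0; rewrite raddf0 subrr (seminorm_0 NLP).
- exists (z + z'); rewrite raddfD opprD addrACA.
  by apply: le_lt_trans (NLD _ _) _; rewrite gt_max zy.
have c1 : 0 < vL c + 1 by rewrite ltr_wpDl // val_ge0.
have [|k kb] := @approx b (e / (vL c + 1)); first by rewrite divr_gt0.
exists (c *: btens_kd k).
rewrite linearZ /= psi_tens scale1r kaehler_mapE -scalerBr.
have -> : kd (i \o f) (i k) - kd (i \o f) b = kd (i \o f) (i k - b).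
  have [dD _ _] := kd_derivation (i \o f).
  by apply/eqP; rewrite subr_eq -dD subrK.
apply: le_lt_trans (NLZ _ _) _.
apply: (@le_lt_trans _ _ (vL c * vL (i k - b))).
  by rewrite ler_wpM2l ?val_ge0 // kaehler_seminorm_kd.
rewrite ltr_pdivlMr // mulrC in kb; apply: le_lt_trans kb.
by rewrite ler_wpM2r ?val_ge0 // lerDl.
Qed.

End DenseExtension.

Theorem theorem5p6p6 (R : realType) (A : comPzRingType) (K L : fieldType)
    (vK : valuation R K) (vL : valuation R L)
    (i : {rmorphism K -> L}) (f : {rmorphism A -> K})
    (i_ext : forall x : K, vL (i x) = vK x)
    (K_dense : dense (range i : set (seminormed vL))) :
  (forall z : bchange i (kaehler f),
     kaehler_seminorm vL (i \o f) (psi f i z)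
       = tensor_seminorm i (kaehler_seminorm vK f) vL z) /\
  dense (range (psi f i) : set (seminormed (kaehler_seminorm vL (i \o f)))).
Proof.
by split; [move=> z; apply: psi_isometry|apply: psi_dense].
Qed.
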